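(* The function $$f_{0}(x)=\ln \Gamma(x+1)-\ln\sqrt{2\pi}-\left(x+\frac12\right)\ln x+x-\frac{x}{2}\ln\left(x\sinh\frac1x\right)-\frac{7}{324}\cdot\frac{1}{x^{3}(35x^{2}+33)}$$ is strictly decreasing and convex from $(1,\infty)$ onto $(0,f_{0}(1))$, where $$f_{0}(1)=\frac{22025}{22032}-\ln\sqrt{2\pi\sinh 1}\approx 0.00002407.$$
   Context: $\Gamma(x)=\int_{0}^{\infty}t^{x-1}e^{-t}\,dt$ for $x>0$ is the gamma function. The function $f_0$ is defined by the displayed formula for all real $x>0$. ''From $(1,\infty)$ onto $(0,f_0(1))$'' means that the image of the interval $(1,\infty)$ under $f_0$ is exactly the open interval $(0,f_0(1))$. *)

(* Defs.v *)
From Stdlib Require Import Reals.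
From Coquelicot Require Import Coquelicot.
Open Scope R_scope.

(* [Rpower] is only meaningful for a positive base: the lower bound of the
   improper Riemann integral tends to 0 from the right, so that t > 0. *)
Definition Gamma (x : R) : R :=
  RInt_gen (fun t => Rpower t (x - 1) * exp (- t))
           (at_right 0) (Rbar_locally p_infty).

(* Meant for x > 0; the values at x <= 0 are junk. *)
Definition f0 (x : R) : R :=
  ln (Gamma (x + 1)) - ln (sqrt (2 * PI)) - (x + 1 / 2) * ln x + x
  - x / 2 * ln (x * sinh (1 / x))
  - 7 / 324 * (1 / (x ^ 3 * (35 * x ^ 2 + 33))).

Definition strict_decreasing_on (D : R -> Prop) (f : R -> R) : Prop :=
  forall x y : R, D x -> D y -> x < y -> f y < f x.

(* To be used for an interval D. *)
Definition convex_on (D : R -> Prop) (f : R -> R) : Prop :=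
  forall x y t : R, D x -> D y -> 0 <= t <= 1 ->
    f (t * x + (1 - t) * y) <= t * f x + (1 - t) * f y.

(* Main.v *)
Require Import Defs.
From Stdlib Require Import Reals Ranalysis5 Lra Lia.
From Coquelicot Require Import Coquelicot.
Open Scope R_scope.

(** Write [f0 = binet - corr], where [binet] is the remainder in Stirling's
    formula and [corr] gathers the elementary terms.  The functional equation
    of Gamma removes Gamma from the difference
    [f0 x - f0 (x + 1) = gap x], which is elementary, and [f0 (x + n)] tends
    to 0 as n grows (lemma [f0_lim]); hence [f0 x] is the sum of the
    [gap (x + n)].  No derivative of Gamma is ever taken.

    Since the [sinh] term of [corr] has a second derivative that involves only
    [csch^2 (1 / x)], the second derivative of [gap] is bounded below by a
    rational function once [csch^2] is enclosed between truncations of its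
    Laurent series.  In the variable [y = x - 1] the numerator and the
    denominator of this rational function have only positive coefficients, so
    [gap] is strictly convex on [1, oo) ([gap2_pos]), and so is the sum [f0]
    ([strictly_convex_telescope]).  A strictly convex function that tends to 0
    along every progression [x + n] strictly decreases
    ([strictly_decreasing_of_convex]), and therefore it is positive.  Together
    with continuity up to the point 1 this gives the image.

    The limit 0 is Stirling's formula.  Along the integers it comes from the
    monotonicity of [binet] and from Wallis' integrals.  For other arguments it
    follows from the bounds of [ln_Gamma_bounds], obtained by integrating
    a tangent-line inequality for [t ^ x]; these bounds also give the
    continuity of Gamma.

    The value [f0 1] is so small that about ten correct digits of PI and of
    [exp (- 1)] are needed: they come from Machin's formula and from Taylor
    polynomials. *)

(** * Taylor enclosures of cosh and sinh *)

Lemma le_of_derive_nonneg (f df : R -> R) (a b : R) :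
  a <= b ->
  (forall t, a <= t <= b -> is_derive f t (df t)) ->
  (forall t, a <= t <= b -> 0 <= df t) ->
  f a <= f b.
Proof.
  intros Hab Hf Hdf.
  destruct (MVT_gen f a b df) as [c [Hc Heq]].
  - intros x Hx. rewrite Rmin_left, Rmax_right in Hx by lra. apply Hf; lra.
  - intros x Hx. rewrite Rmin_left, Rmax_right in Hx by lra.
    apply continuity_pt_filterlim. apply (ex_derive_continuous (V := R_NormedModule)).
    exists (df x). apply Hf; lra.
  - rewrite Rmin_left, Rmax_right in Hc by lra.
    specialize (Hdf c Hc). nra.
Qed.

(** The monomial [t ^ k / k!].  The recursion turns every coefficient into
    integer literals under [simpl], whereas [fact 13] is a huge unary number. *)
Fixpoint mono (k : nat) (t : R) : R :=
  match k with
  | O => 1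
  | S k' => mono k' t * t / IZR (Z.of_nat (S k'))
  end.

(** Taylor polynomial at 0 of degree [k] of [cosh] for even [k] and of [sinh]
    for odd [k].  With this indexing one derivation lowers the index by one, for
    the polynomials as for the functions, which makes one induction serve both. *)
Fixpoint hyp_taylor (k : nat) (t : R) : R :=
  match k with
  | O => 1
  | S O => t
  | S (S k' as k1) => hyp_taylor k' t + mono (S k1) t
  end.

Definition hyp (k : nat) : R -> R := if Nat.even k then cosh else sinh.

Lemma is_derive_mono (k : nat) (t : R) : is_derive (mono (S k)) t (mono k t).
Proof.
  induction k as [|k IH].
  - simpl. auto_derive; trivial. lra.
  - change (mono (S (S k))) with (fun t => mono (S k) t * t / IZR (Z.of_nat (S (S k)))).
    change (mono (S k) t) with (mono k t * t / IZR (Z.of_nat (S k))) in *.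
    assert (Hn : 0 < IZR (Z.of_nat (S k))) by (apply IZR_lt; lia).
    assert (Hn' : IZR (Z.of_nat (S (S k))) = IZR (Z.of_nat (S k)) + 1)
      by (rewrite <- plus_IZR; f_equal; lia).
    rewrite Hn'.
    apply (is_derive_ext (fun t => / (IZR (Z.of_nat (S k)) + 1) * (mono (S k) t * t))).
    { intros s; unfold Rdiv; apply Rmult_comm. }
    replace (mono k t * t / IZR (Z.of_nat (S k))) with
      (/ (IZR (Z.of_nat (S k)) + 1) * (mono k t * t + mono (S k) t * 1)).
    2: { change (mono (S k) t) with (mono k t * t / IZR (Z.of_nat (S k))).
         field; lra. }
    refine (is_derive_scal _ _ _ _ _).
    refine (is_derive_mult _ _ _ _ _ IH (is_derive_id _) _); intros; apply Rmult_comm.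
Qed.

Lemma is_derive_hyp_taylor (k : nat) (t : R) :
  is_derive (hyp_taylor (S k)) t (hyp_taylor k t).
Proof.
  cut (is_derive (hyp_taylor (S k)) t (hyp_taylor k t) /\
       is_derive (hyp_taylor (S (S k))) t (hyp_taylor (S k) t)).
  { tauto. }
  induction k as [|k [IH1 IH2]].
  - split.
    + simpl. auto_derive; trivial.
    + change (hyp_taylor 2) with (fun t => 1 + mono 2 t).
      change (hyp_taylor 1 t) with t.
      simpl. auto_derive; trivial. lra.
  - split; [exact IH2|].
    change (hyp_taylor (S (S (S k)))) with
      (fun t => hyp_taylor (S k) t + mono (S (S (S k))) t).
    change (hyp_taylor (S (S k)) t) with (hyp_taylor k t + mono (S (S k)) t).
    refine (is_derive_plus _ _ _ _ _ _ _); [exact IH1 | apply is_derive_mono].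
Qed.

Lemma is_derive_sinh (t : R) : is_derive sinh t (cosh t).
Proof. apply is_derive_Reals, derivable_pt_lim_sinh. Qed.

Lemma is_derive_cosh (t : R) : is_derive cosh t (sinh t).
Proof. apply is_derive_Reals, derivable_pt_lim_cosh. Qed.

Lemma is_derive_hyp (k : nat) (t : R) : is_derive (hyp (S k)) t (hyp k t).
Proof.
  unfold hyp. rewrite Nat.even_succ, <- Nat.negb_even.
  destruct (Nat.even k); [apply is_derive_sinh | apply is_derive_cosh].
Qed.

Lemma hyp_0 (k : nat) : hyp (S k) 0 = hyp_taylor (S k) 0.
Proof.
  assert (Hm : forall j, mono (S j) 0 = 0) by (intros j; simpl; unfold Rdiv; ring).
  cut (hyp (S k) 0 = hyp_taylor (S k) 0 /\ hyp (S (S k)) 0 = hyp_taylor (S (S k)) 0).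
  { tauto. }
  induction k as [|k [IH1 IH2]].
  - change (hyp 1 0) with (sinh 0). change (hyp 2 0) with (cosh 0).
    change (hyp_taylor 2 0) with (1 + mono 2 0). rewrite Hm, sinh_0, cosh_0.
    simpl; split; ring.
  - split; [exact IH2|].
    change (hyp_taylor (S (S (S k))) 0) with
      (hyp_taylor (S k) 0 + mono (S (S (S k))) 0).
    rewrite Hm, Rplus_0_r, <- IH1. reflexivity.
Qed.

(** Each step of the induction integrates the previous inequality from 0, where
    the function and its Taylor polynomial agree. *)
Lemma hyp_ge_taylor (k : nat) (t : R) : 0 <= t -> hyp_taylor k t <= hyp k t.
Proof.
  revert t; induction k as [|k IH]; intros t Ht.
  - change (1 <= cosh t).
    rewrite <- cosh_0.
    apply (le_of_derive_nonneg cosh sinh); [exact Ht | intros; apply is_derive_cosh |].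
    intros s [[Hs| <-] _]; [|rewrite sinh_0; lra].
    left. rewrite <- sinh_0. apply sinh_lt, Hs.
  - cut (hyp (S k) 0 - hyp_taylor (S k) 0 <= hyp (S k) t - hyp_taylor (S k) t).
    { rewrite hyp_0; lra. }
    apply (le_of_derive_nonneg (fun t => hyp (S k) t - hyp_taylor (S k) t)
             (fun t => hyp k t - hyp_taylor k t)); [exact Ht | |].
    + intros s _. refine (is_derive_minus _ _ _ _ _ _ _); [apply is_derive_hyp | apply is_derive_hyp_taylor].
    + intros s Hs. specialize (IH s). lra.
Qed.

(** The same induction, started from [cosh t <= 2] on [0, 1]: integrating the
    constant 2 instead of 1 doubles the last monomial. *)
Lemma hyp_le_taylor (k : nat) (t : R) :
  0 <= t <= 1 -> hyp k t <= hyp_taylor k t + mono k t.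
Proof.
  revert t; induction k as [|k IH]; intros t Ht.
  - change (cosh t <= 1 + 1). unfold cosh.
    assert (H1 : exp t <= 3).
    { apply Rle_trans with (exp 1); [|apply exp_le_3].
      destruct (proj2 Ht) as [H| ->]; [left; apply exp_increasing, H | lra]. }
    assert (H2 : exp (- t) <= 1).
    { rewrite <- exp_0. destruct (proj1 Ht) as [H| <-].
      - left; apply exp_increasing; lra.
      - rewrite Ropp_0; lra. }
    lra.
  - cut (hyp_taylor (S k) 0 + mono (S k) 0 - hyp (S k) 0
         <= hyp_taylor (S k) t + mono (S k) t - hyp (S k) t).
    { rewrite hyp_0. replace (mono (S k) 0) with 0 by (simpl; unfold Rdiv; ring). lra. }
    apply (le_of_derive_nonneg (fun t => hyp_taylor (S k) t + mono (S k) t - hyp (S k) t)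
             (fun t => hyp_taylor k t + mono k t - hyp k t)); [lra | |].
    + intros s _. refine (is_derive_minus _ _ _ _ _ _ _); [|apply is_derive_hyp].
      refine (is_derive_plus _ _ _ _ _ _ _); [apply is_derive_hyp_taylor | apply is_derive_mono].
    + intros s Hs. specialize (IH s). lra.
Qed.

(** * Rational bounds for csch^2, and convexity of the difference *)

(** The first five terms of the expansion at 0 of [1 / t ^ 2 - csch^2 t], the
    opposite of the second derivative of [ln t - ln (sinh t)].  The coefficients
    alternate, so that five terms give an upper bound.  Five is the least number
    which resolves the decay of [f0 x] like [x ^ (-9)]. *)
Definition csch2_tail (t : R) : R :=
  1/3 - t^2/15 + 2*t^4/189 - t^6/675 + 2*t^8/10395.

(** For polynomials in nonnegative variables with nonnegative coefficients. *)
Ltac nonneg_poly :=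
  lazymatch goal with
  | |- 0 <= _ + _ => apply Rplus_le_le_0_compat; nonneg_poly
  | |- 0 <= _ * _ => apply Rmult_le_pos; nonneg_poly
  | |- 0 <= _ ^ _ => apply pow_le; nonneg_poly
  | |- _ => first [assumption | lra]
  end.

(** It suffices to bound [sinh t] above by a polynomial [p]; the inequality
    between [p ^ 2] and [csch2_tail] has only nonnegative coefficients after
    expansion. *)
Lemma csch2_lower (t : R) :
  0 < t <= 1 -> 1 / t^2 - csch2_tail t <= / sinh t ^ 2.
Proof.
  intros Ht.
  assert (Hs : 0 < sinh t) by (rewrite <- sinh_0; apply sinh_lt; lra).
  assert (H := hyp_le_taylor 13 t ltac:(lra)).
  change (hyp 13 t) with (sinh t) in H.
  set (p := hyp_taylor 13 t + mono 13 t) in H.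
  apply Rle_trans with (/ p ^ 2).
  - assert (Hp : 0 < p) by lra.
    apply (Rmult_le_reg_r (p^2 * t^2)). { apply Rmult_lt_0_compat; apply pow_lt; lra. }
    replace (/ p^2 * (p^2 * t^2)) with (t^2) by (field; lra).
    replace ((1 / t ^ 2 - csch2_tail t) * (p ^ 2 * t ^ 2))
      with (p^2 * (1 - t^2 * csch2_tail t)) by (field; lra).
    apply Rminus_le_0.
    assert (Ht0 : 0 <= t) by lra. clear - Ht0.
    subst p; unfold csch2_tail; simpl mono; simpl hyp_taylor.
    match goal with |- 0 <= ?e => field_simplify e end.
    apply Rmult_le_pos; [nonneg_poly | lra].
  - apply Rinv_le_contravar. { apply pow_lt, Hs. }
    apply pow_incr; lra.
Qed.

(** The next coefficient of the expansion is [- 1382 / 58046625], or about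
    [- 2.38 / 100000]; rounding it to [- 1 / 40000] leaves room for replacing
    [sinh] by a Taylor polynomial. *)
Lemma csch2_upper (t : R) :
  0 < t -> / sinh t ^ 2 <= 1 / t^2 - csch2_tail t + t^10 / 40000.
Proof.
  intros Ht.
  assert (H := hyp_ge_taylor 11 t ltac:(lra)).
  change (hyp 11 t) with (sinh t) in H.
  set (p := hyp_taylor 11 t) in H.
  assert (Hp : t <= p).
  { assert (Ht0 : 0 <= t) by lra. clear - Ht0.
    apply Rminus_le_0. subst p; simpl mono; simpl hyp_taylor.
    match goal with |- 0 <= ?e => field_simplify e end.
    apply Rmult_le_pos; [nonneg_poly | lra]. }
  apply Rle_trans with (/ p ^ 2).
  - apply Rinv_le_contravar. { apply pow_lt; lra. }
    apply pow_incr; lra.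
  - apply (Rmult_le_reg_r (p^2 * t^2)). { apply Rmult_lt_0_compat; apply pow_lt; lra. }
    replace (/ p^2 * (p^2 * t^2)) with (t^2) by (field; lra).
    replace ((1 / t ^ 2 - csch2_tail t + t^10 / 40000) * (p ^ 2 * t ^ 2))
      with (p^2 * (1 - t^2 * (csch2_tail t - t^10 / 40000))) by (field; lra).
    apply Rminus_le_0.
    assert (Ht0 : 0 <= t) by lra. clear - Ht0.
    subst p; unfold csch2_tail; simpl mono; simpl hyp_taylor.
    match goal with |- 0 <= ?e => field_simplify e end.
    apply Rmult_le_pos; [nonneg_poly | lra].
Qed.

(** The part of [f0] that does not come from Stirling's formula, with the sign
    changed. *)
Definition corr (x : R) : R :=
  x / 2 * ln (x * sinh (1 / x)) + 7 / 324 * (1 / (x ^ 3 * (35 * x ^ 2 + 33))).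

Definition corr1 (x : R) : R :=
  1 / 2 * ln (x * sinh (1 / x)) + 1 / 2 - cosh (1 / x) / sinh (1 / x) / (2 * x)
  - 7 / 324 * (175 * x ^ 2 + 99) / (x ^ 4 * (35 * x ^ 2 + 33) ^ 2).

(** Second derivative of the rational term of [corr]. *)
Definition rat2 (x : R) : R :=
  7 / 324 * (2 * (175 * x ^ 2 + 99) ^ 2 - (35 * x ^ 2 + 33) * (700 * x ^ 2 + 198))
  / (x ^ 5 * (35 * x ^ 2 + 33) ^ 3).

(** Second derivative of [corr].  In the [sinh] part the logarithm and the
    hyperbolic cotangent cancel; this makes a rational enclosure possible. *)
Definition corr2 (x : R) : R := (x ^ 2 - / sinh (1 / x) ^ 2) / (2 * x ^ 3) + rat2 x.

Lemma sinh_inv_pos (x : R) : 0 < x -> 0 < sinh (1 / x).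
Proof.
  intros Hx. rewrite <- sinh_0. apply sinh_lt.
  unfold Rdiv; rewrite Rmult_1_l; apply Rinv_0_lt_compat, Hx.
Qed.

Lemma is_derive_rat1 (x : R) : 0 < x ->
  is_derive (fun x => 7 / 324 * (1 / (x ^ 3 * (35 * x ^ 2 + 33)))) x
    (- (7 / 324 * (175 * x ^ 2 + 99) / (x ^ 4 * (35 * x ^ 2 + 33) ^ 2))).
Proof.
  intros Hx. assert (0 < x ^ 2) by (apply pow_lt, Hx). assert (0 < x ^ 3) by (apply pow_lt, Hx).
  auto_derive; [nra | field; nra].
Qed.

Lemma is_derive_rat2 (x : R) : 0 < x ->
  is_derive (fun x => - (7 / 324 * (175 * x ^ 2 + 99) / (x ^ 4 * (35 * x ^ 2 + 33) ^ 2)))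
    x (rat2 x).
Proof.
  intros Hx. assert (0 < x ^ 2) by (apply pow_lt, Hx). assert (0 < x ^ 4) by (apply pow_lt, Hx).
  assert (0 < (35 * x ^ 2 + 33) ^ 2) by (apply pow_lt; lra).
  unfold rat2; auto_derive; [nra | field; nra].
Qed.

Lemma is_derive_corr (x : R) : 0 < x -> is_derive corr x (corr1 x).
Proof.
  intros Hx. pose proof (sinh_inv_pos x Hx) as Hs.
  refine (is_derive_plus _ _ _ _ _ _ (is_derive_rat1 x Hx)).
  auto_derive.
  - change (1 * / x) with (1 / x). repeat split; nra.
  - change (1 * / x) with (1 / x). field; lra.
Qed.

Lemma cosh_sqr (t : R) : cosh t ^ 2 = 1 + sinh t ^ 2.
Proof.
  assert (E : exp t * exp (- t) = 1) by (rewrite <- exp_plus, Rplus_opp_r; apply exp_0).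
  unfold cosh, sinh; nra.
Qed.

Lemma is_derive_corr1 (x : R) : 0 < x -> is_derive corr1 x (corr2 x).
Proof.
  intros Hx. pose proof (sinh_inv_pos x Hx) as Hs.
  refine (is_derive_plus _ _ _ _ _ _ (is_derive_rat2 x Hx)).
  auto_derive.
  - change (1 * / x) with (1 / x). repeat split; nra.
  - change (1 * / x) with (1 / x).
    field_simplify; [rewrite cosh_sqr; field | | ]; nra.
Qed.

(** The difference [f0 x - f0 (x + 1)], with Gamma removed by its functional
    equation. *)
Definition gap (x : R) : R :=
  (x + 1 / 2) * (ln (x + 1) - ln x) - 1 - corr x + corr (x + 1).

Definition gap1 (x : R) : R :=
  ln (x + 1) - ln x + (x + 1 / 2) * (1 / (x + 1) - 1 / x) - corr1 x + corr1 (x + 1).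

Definition gap2 (x : R) : R :=
  1 / (2 * x ^ 2 * (x + 1) ^ 2) - corr2 x + corr2 (x + 1).

Lemma is_derive_shift (f : R -> R) (x l : R) :
  is_derive f (x + 1) l -> is_derive (fun x => f (x + 1)) x l.
Proof.
  intros H. rewrite <- (scal_one l).
  refine (is_derive_comp f (fun x => x + 1) x l 1 H _).
  auto_derive; trivial.
Qed.

Lemma is_derive_gap (x : R) : 0 < x -> is_derive gap x (gap1 x).
Proof.
  intros Hx.
  refine (is_derive_plus (V := R_NormedModule) _ _ _ _ _ _
            (is_derive_shift _ _ _ (is_derive_corr _ _))); [|lra].
  refine (is_derive_minus _ _ _ _ _ _ (is_derive_corr _ Hx)).
  auto_derive; [lra | field; lra].
Qed.

Lemma is_derive_gap1 (x : R) : 0 < x -> is_derive gap1 x (gap2 x).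
Proof.
  intros Hx.
  refine (is_derive_plus (V := R_NormedModule) _ _ _ _ _ _
            (is_derive_shift _ _ _ (is_derive_corr1 _ _))); [|lra].
  refine (is_derive_minus _ _ _ _ _ _ (is_derive_corr1 _ Hx)).
  auto_derive; [lra | field; lra].
Qed.

(** The bounds on [csch^2] are used at [1 / x] and at [1 / (x + 1)], in opposite
    directions.  What remains is a rational function of [x], whose leading terms
    cancel down to order [x ^ (-12)]. *)
Lemma gap2_pos (x : R) : 1 <= x -> 0 < gap2 x.
Proof.
  intros Hx.
  assert (Ht : 0 < 1 / x <= 1).
  { split; [apply Rdiv_lt_0_compat; lra |].
    apply (Rmult_le_reg_r x); [lra|]. field_simplify; lra. }
  assert (Ht' : 0 < 1 / (x + 1)) by (apply Rdiv_lt_0_compat; lra).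
  assert (H1 := csch2_lower _ Ht). assert (H2 := csch2_upper _ Ht').
  assert (H3 : (x ^ 2 - / sinh (1 / x) ^ 2) / (2 * x ^ 3) <= csch2_tail (1 / x) / (2 * x ^ 3)).
  { apply Rmult_le_compat_r.
    - left; apply Rinv_0_lt_compat. assert (0 < x ^ 3) by (apply pow_lt; lra); lra.
    - replace (1 / (1 / x) ^ 2) with (x ^ 2) in H1 by (field; lra). lra. }
  assert (H4 : (csch2_tail (1 / (x + 1)) - (1 / (x + 1)) ^ 10 / 40000) / (2 * (x + 1) ^ 3)
               <= ((x + 1) ^ 2 - / sinh (1 / (x + 1)) ^ 2) / (2 * (x + 1) ^ 3)).
  { apply Rmult_le_compat_r.
    - left; apply Rinv_0_lt_compat. assert (0 < (x + 1) ^ 3) by (apply pow_lt; lra); lra.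
    - replace (1 / (1 / (x + 1)) ^ 2) with ((x + 1) ^ 2) in H2 by (field; lra). lra. }
  unfold gap2, corr2.
  apply Rlt_le_trans with
    (1 / (2 * x ^ 2 * (x + 1) ^ 2) - (csch2_tail (1 / x) / (2 * x ^ 3) + rat2 x)
     + ((csch2_tail (1 / (x + 1)) - (1 / (x + 1)) ^ 10 / 40000) / (2 * (x + 1) ^ 3)
        + rat2 (x + 1))); [|lra].
  clear - Hx.
  (* Expanded at [x = 1], numerator and denominator have only positive
     coefficients; the numerator does have negative ones when expanded at 0. *)
  replace x with ((x - 1) + 1) by ring.
  assert (Hy : 0 <= x - 1) by lra. revert Hy; generalize (x - 1); clear; intros y Hy.
  assert (0 <= y ^ 2) by (apply pow_le, Hy).
  unfold csch2_tail, rat2.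
  match goal with |- 0 < ?e => field_simplify e end.
  - apply Rdiv_lt_0_compat; (apply Rplus_le_lt_0_compat; [nonneg_poly | lra]).
  - repeat split; nra.
Qed.

(** * The Gamma integral *)

(** Real-valued specialization of the improper integral that defines [Gamma]. *)
Definition is_RInt_half_line (f : R -> R) (l : R) : Prop :=
  is_RInt_gen f (at_right 0) (Rbar_locally p_infty) l.

Lemma is_RInt_half_line_scal (f : R -> R) (k l : R) :
  is_RInt_half_line f l -> is_RInt_half_line (fun t => k * f t) (k * l).
Proof. exact (is_RInt_gen_scal f k l). Qed.

Lemma is_RInt_half_line_minus (f g : R -> R) (lf lg : R) :
  is_RInt_half_line f lf -> is_RInt_half_line g lg ->
  is_RInt_half_line (fun t => f t - g t) (lf - lg).
Proof. exact (is_RInt_gen_minus f g lf lg). Qed.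

Lemma is_RInt_half_line_unique (f : R -> R) (l l' : R) :
  is_RInt_half_line f l -> is_RInt_half_line f l' -> l = l'.
Proof.
  intros H H'. rewrite <- (is_RInt_gen_unique (V := R_CompleteNormedModule) _ _ H).
  apply (is_RInt_gen_unique (V := R_CompleteNormedModule) _ _ H').
Qed.

Lemma is_RInt_half_line_intro (f : R -> R) (l : R) :
  (forall a b, 0 < a <= b -> ex_RInt f a b) ->
  (forall eps : posreal, exists a0 b0, 0 < a0 <= b0 /\
     forall a b, 0 < a < a0 -> b0 < b -> Rabs (RInt f a b - l) < eps) ->
  is_RInt_half_line f l.
Proof.
  intros Hf Hl. apply filterlimi_locally. intros eps.
  destruct (Hl eps) as [a0 [b0 [H0 Hab]]].
  apply (Filter_prod _ _ _ (fun a => 0 < a < a0) (fun b => b0 < b)).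
  - exists (mkposreal a0 (proj1 H0)); simpl. intros a Ha Hpos.
    change (Rabs (a - 0) < a0) in Ha. apply Rabs_lt_between in Ha. lra.
  - exists b0; auto.
  - intros a b Ha Hb. exists (RInt f a b); split; simpl.
    + apply (RInt_correct f a b), Hf; lra.
    + apply Hab; assumption.
Qed.

(** The integral of a nonnegative function grows with the interval, so it
    converges to its supremum. *)
Lemma ex_RInt_half_line_of_bounded (f : R -> R) (M : R) :
  (forall t, 0 < t -> continuous f t) ->
  (forall t, 0 < t -> 0 <= f t) ->
  (forall a b, 0 < a <= b -> RInt f a b <= M) ->
  exists l, is_RInt_half_line f l.
Proof.
  intros Hc Hpos HM.
  assert (Hex : forall a b, 0 < a -> 0 < b -> ex_RInt f a b).
  { intros a b Ha Hb. apply (ex_RInt_continuous (V := R_CompleteNormedModule)).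
    intros z Hz. apply Hc. assert (0 < Rmin a b) by (apply Rmin_pos; assumption). lra. }
  destruct (completeness (fun y => exists a b, 0 < a <= b /\ y = RInt f a b)) as [l [Hub Hlub]].
  - exists M. intros y [a [b [Hab ->]]]. apply HM, Hab.
  - exists (RInt f 1 1), 1, 1. lra.
  - exists l. apply is_RInt_half_line_intro.
    { intros a b Hab; apply Hex; lra. }
    intros eps.
    destruct (Classical_Prop.classic (exists a b, 0 < a <= b /\ l - eps < RInt f a b))
      as [[a0 [b0 [H0 H1]]] | Hn].
    + exists a0, b0; split; [exact H0|]. intros a b Ha Hb.
      assert (RInt f a b <= l) by (apply Hub; exists a, b; split; [lra | reflexivity]).
      assert (E : RInt f a b = RInt f a a0 + RInt f a0 b0 + RInt f b0 b).
      { rewrite <- (RInt_Chasles f a b0 b), <- (RInt_Chasles f a a0 b0);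
          try (apply Hex; lra). reflexivity. }
      assert (0 <= RInt f a a0).
      { apply RInt_ge_0; [lra | apply Hex; lra | intros; apply Hpos; lra]. }
      assert (0 <= RInt f b0 b).
      { apply RInt_ge_0; [lra | apply Hex; lra | intros; apply Hpos; lra]. }
      destruct eps as [e He]; simpl in *. apply Rabs_def1; lra.
    + exfalso. apply (Rlt_irrefl l). apply Rle_lt_trans with (l - eps).
      * apply Hlub. intros y [a [b [Hab ->]]].
        destruct (Rle_or_lt (RInt f a b) (l - eps)) as [H|H]; [exact H|].
        exfalso; apply Hn; exists a, b; auto.
      * destruct eps; simpl; lra.
Qed.

Lemma exp_le_compat (x y : R) : x <= y -> exp x <= exp y.
Proof. intros [H| ->]; [left; apply exp_increasing, H | apply Rle_refl]. Qed.

Definition gamma_fun (s t : R) : R := Rpower t (s - 1) * exp (- t).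

Lemma gamma_fun_pos (s t : R) : 0 < gamma_fun s t.
Proof. apply Rmult_lt_0_compat; apply exp_pos. Qed.

Lemma is_derive_Rpower (p t : R) : 0 < t ->
  is_derive (fun t => Rpower t p) t (p * Rpower t (p - 1)).
Proof.
  intros Ht. apply is_derive_Reals, derivable_pt_lim_power, Ht.
Qed.

Lemma gamma_fun_continuous (s t : R) : 0 < t -> continuous (gamma_fun s) t.
Proof.
  intros Ht. apply (ex_derive_continuous (V := R_NormedModule)).
  unfold gamma_fun. auto_derive. repeat split; auto.
  eexists. apply is_derive_Rpower, Ht.
Qed.

(** An exponential majorant valid down to 0 requires [1 <= s]; only such
    arguments of Gamma occur. *)
Lemma gamma_fun_le_exp (s : R) : 1 <= s ->
  exists C, 0 < C /\ forall t, 0 < t -> gamma_fun s t <= C * exp (- (t / 2)).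
Proof.
  intros Hs. exists (exp ((s - 1) * ln (2 * (s - 1)))). split; [apply exp_pos|].
  intros t Ht. unfold gamma_fun, Rpower. rewrite <- !exp_plus.
  apply exp_le_compat.
  destruct (Req_dec s 1) as [-> | Hs1]. { nra. }
  assert (Hp : 0 < s - 1) by lra. set (p := s - 1) in *.
  assert (H : ln t <= ln (2 * p) + t / (2 * p)).
  { replace t with ((2 * p) * (t / (2 * p))) at 1 by (field; lra).
    assert (Hq : 0 < t / (2 * p)) by (apply Rdiv_lt_0_compat; lra).
    rewrite ln_mult by lra.
    generalize (exp_ineq1_le (ln (t / (2 * p)))). rewrite exp_ln by exact Hq. lra. }
  apply (Rmult_le_compat_l p) in H; [|lra].
  replace (p * (ln (2 * p) + t / (2 * p))) with (p * ln (2 * p) + t / 2) in H by (field; lra).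
  lra.
Qed.

Lemma is_Gamma (s : R) : 1 <= s ->
  is_RInt_half_line (gamma_fun s) (Gamma s).
Proof.
  intros Hs. apply (RInt_gen_correct (gamma_fun s)).
  destruct (gamma_fun_le_exp s Hs) as [C [HC Hle]].
  apply (ex_RInt_half_line_of_bounded _ (2 * C)).
  - apply gamma_fun_continuous.
  - intros; left; apply gamma_fun_pos.
  - intros a b Hab.
    set (F := fun t => - (2 * C) * exp (- (t / 2))).
    assert (HF : is_RInt (fun t => C * exp (- (t / 2))) a b (F b - F a)).
    { apply (is_RInt_derive F).
      - intros t _. unfold F. auto_derive; trivial. unfold Rdiv; field.
      - intros t _. apply (ex_derive_continuous (V := R_NormedModule)).
        auto_derive; trivial. }
    apply Rle_trans with (F b - F a).
    + rewrite <- (is_RInt_unique _ _ _ _ HF). apply RInt_le; [lra | | eexists; exact HF | ].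
      * apply (ex_RInt_continuous (V := R_CompleteNormedModule)). intros z Hz.
        rewrite Rmin_left in Hz by lra. apply gamma_fun_continuous; lra.
      * intros t Ht; apply Hle; lra.
    + unfold F. assert (H1 := exp_pos (- (b / 2))).
      assert (H2 : exp (- (a / 2)) <= 1) by (rewrite <- exp_0; apply exp_le_compat; lra).
      nra.
Qed.

(** A nonnegative function is equal to its norm, so the norm inequality for
    improper integrals applies with the function on both sides. *)
Lemma is_RInt_half_line_ge_0 (g : R -> R) (l : R) :
  (forall t, 0 < t -> 0 <= g t) ->
  is_RInt_half_line g l -> 0 <= l.
Proof.
  intros Hg Hl. apply Rle_trans with (norm l); [apply norm_ge_0|].
  apply (RInt_gen_norm (Fa := at_right 0) (Fb := Rbar_locally p_infty) g g); trivial.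
  - apply (Filter_prod _ _ _ (fun a => a < 1) (fun b => 1 < b)).
    + exists (mkposreal 1 Rlt_0_1). simpl. intros y Hy _.
      change (Rabs (y - 0) < 1) in Hy. apply Rabs_lt_between in Hy. lra.
    + exists 1; auto.
    + simpl; intros; lra.
  - apply (Filter_prod _ _ _ (fun a => 0 < a) (fun b => True)).
    + exists (mkposreal 1 Rlt_0_1); auto.
    + exists 0; auto.
    + simpl. intros a b Ha _ t Ht. change (Rabs (g t) <= g t).
      rewrite Rabs_pos_eq; [lra | apply Hg; lra].
Qed.

(** Together with [gamma_fun_lim_p], this kills the boundary terms of the
    integration by parts in [Gamma_succ], where [gamma_fun (s + 1)] is the
    primitive. *)
Lemma gamma_fun_lim_0 (s : R) : 2 <= s ->
  filterlim (gamma_fun s) (at_right 0) (locally 0).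
Proof.
  intros Hs. apply (filterlim_locally (gamma_fun s) 0). intros [e He].
  exists (mkposreal _ (Rmin_pos 1 e Rlt_0_1 He)). intros t Ht Ht0.
  change (Rabs (t - 0) < Rmin 1 e) in Ht. apply Rabs_lt_between in Ht.
  assert (Hte : t < 1 /\ t < e) by (generalize (Rmin_l 1 e) (Rmin_r 1 e); lra).
  change (Rabs (gamma_fun s t - 0) < e).
  assert (H := gamma_fun_pos s t). rewrite Rminus_0_r, Rabs_pos_eq by lra.
  apply Rle_lt_trans with t; [|lra].
  unfold gamma_fun, Rpower. rewrite <- exp_plus.
  rewrite <- (exp_ln t) at 3 by exact Ht0. apply exp_le_compat.
  assert (ln t < 0) by (rewrite <- ln_1; apply ln_increasing; lra). nra.
Qed.

Lemma gamma_fun_lim_p (s : R) : 1 <= s ->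
  filterlim (gamma_fun s) (Rbar_locally p_infty) (locally 0).
Proof.
  intros Hs. destruct (gamma_fun_le_exp s Hs) as [C [HC Hle]].
  apply (filterlim_locally (gamma_fun s) 0). intros [e He].
  exists (2 * C / e). intros t Ht.
  assert (Ht0 : 0 < t) by (apply Rlt_trans with (2 * C / e); [apply Rdiv_lt_0_compat|]; lra).
  change (Rabs (gamma_fun s t - 0) < e).
  assert (H := gamma_fun_pos s t). rewrite Rminus_0_r, Rabs_pos_eq by lra.
  apply Rle_lt_trans with (C * exp (- (t / 2))); [apply Hle, Ht0|].
  rewrite exp_Ropp. assert (He2 := exp_ineq1_le (t / 2)).
  apply Rmult_lt_reg_r with (exp (t / 2)); [lra|].
  rewrite Rmult_assoc, Rinv_l by lra.
  apply (Rmult_lt_compat_r e) in Ht; [|exact He].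
  replace (2 * C / e * e) with (2 * C) in Ht by (field; lra). nra.
Qed.

Lemma is_RInt_half_line_of_derive (F f : R -> R) (la lb : R) :
  (forall t, 0 < t -> is_derive F t (f t)) ->
  (forall t, 0 < t -> continuous f t) ->
  filterlim F (at_right 0) (locally la) ->
  filterlim F (Rbar_locally p_infty) (locally lb) ->
  is_RInt_half_line f (lb - la).
Proof.
  intros HF Hf Ha Hb.
  assert (Hev : forall P : R -> Prop, (forall t, 0 < t -> P t) ->
    filter_prod (at_right 0) (Rbar_locally p_infty)
      (fun ab : R * R => forall x, Rmin (fst ab) (snd ab) <= x <= Rmax (fst ab) (snd ab) -> P x)).
  { intros P HP. apply (Filter_prod _ _ _ (fun a => 0 < a) (fun b => 0 < b)).
    - exists (mkposreal 1 Rlt_0_1); auto.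
    - exists 0; auto.
    - simpl. intros a b H1 H2 x Hx. apply HP.
      apply Rlt_le_trans with (Rmin a b); [apply Rmin_pos; assumption | apply Hx]. }
  apply (is_RInt_gen_ext (V := R_NormedModule) (Fa := at_right 0) (Fb := Rbar_locally p_infty)
           (Derive F) f (lb - la)).
  - generalize (Hev (fun t => Derive F t = f t) (fun t Ht => is_derive_unique _ _ _ (HF t Ht))).
    apply filter_imp. intros [a b] H x Hx; apply H; simpl in *; lra.
  - apply is_RInt_gen_Derive; trivial.
    + apply Hev. intros t Ht; eexists; apply HF, Ht.
    + apply Hev. intros t Ht. apply continuous_ext_loc with f; [|apply Hf, Ht].
      exists (mkposreal t Ht). intros y Hy. change (Rabs (y - t) < t) in Hy.
      apply Rabs_lt_between in Hy. symmetry. apply is_derive_unique, HF; lra.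
Qed.

Lemma Gamma_succ (s : R) : 1 <= s -> Gamma (s + 1) = s * Gamma s.
Proof.
  intros Hs.
  assert (H : is_RInt_half_line (fun t => s * gamma_fun s t - gamma_fun (s + 1) t) (0 - 0)).
  { apply (is_RInt_half_line_of_derive (gamma_fun (s + 1))).
    - intros t Ht. unfold gamma_fun. replace (s + 1 - 1) with s by ring.
      replace (s * (Rpower t (s - 1) * exp (- t)) - Rpower t s * exp (- t)) with
        (s * Rpower t (s - 1) * exp (- t) + Rpower t s * (- exp (- t))) by ring.
      refine (is_derive_mult (fun t => Rpower t s) (fun t => exp (- t)) t _ _
               (is_derive_Rpower s t Ht) _ _).
      + auto_derive; trivial; ring.
      + intros; apply Rmult_comm.
    - intros t Ht.
      refine (continuous_minus (V := R_NormedModule) (fun t => s * gamma_fun s t) _ t _ _).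
      + refine (continuous_scal_r s (gamma_fun s) t _). apply gamma_fun_continuous, Ht.
      + apply gamma_fun_continuous, Ht.
    - apply gamma_fun_lim_0; lra.
    - apply gamma_fun_lim_p; lra. }
  assert (H' := is_RInt_half_line_minus _ _ _ _ (is_RInt_half_line_scal _ s _ (is_Gamma s Hs))
                  (is_Gamma (s + 1) ltac:(lra))).
  generalize (is_RInt_half_line_unique _ _ _ H H'). lra.
Qed.

Lemma Gamma_1 : Gamma 1 = 1.
Proof.
  assert (H : is_RInt_half_line (gamma_fun 1) (0 - - 1)).
  { apply (is_RInt_half_line_of_derive (fun t => - exp (- t))).
    - intros t Ht. unfold gamma_fun. rewrite Rminus_diag, Rpower_O by exact Ht.
      auto_derive; trivial. ring.
    - apply gamma_fun_continuous.
    - apply (filterlim_filter_le_1 (F := locally 0)); [apply filter_le_within|].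
      replace (- 1) with (- exp (- 0)) by (rewrite Ropp_0, exp_0; ring).
      apply (ex_derive_continuous (V := R_NormedModule) (fun t => - exp (- t))).
      auto_derive; trivial.
    - replace 0 with (- 0) by ring.
      refine (filterlim_comp _ _ _ (fun t => exp (- t)) Ropp _ _ _ _ (filterlim_opp (V := R_NormedModule) 0)).
      refine (filterlim_ext_loc (gamma_fun 1) _ _ (gamma_fun_lim_p 1 (Rle_refl 1))).
      exists 0. intros t Ht. unfold gamma_fun. rewrite Rminus_diag, Rpower_O by exact Ht. ring. }
  rewrite (is_RInt_half_line_unique _ _ _ (is_Gamma 1 (Rle_refl 1)) H). ring.
Qed.

(** From [exp u >= 1 + u] and [ln y >= 1 - 1 / y].  The right-hand side contains
    only [1 / y], so its integral against the Gamma density is again a value of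
    Gamma. *)
Lemma Rpower_ge_tangent (y x : R) : 0 < y -> 0 <= x -> 1 + x - x / y <= Rpower y x.
Proof.
  intros Hy Hx. unfold Rpower.
  assert (H1 := exp_ineq1_le (x * ln y)).
  assert (H2 : 1 - / y <= ln y).
  { generalize (exp_ineq1_le (ln (/ y))).
    rewrite exp_ln by (apply Rinv_0_lt_compat, Hy). rewrite ln_Rinv by exact Hy. lra. }
  unfold Rdiv. nra.
Qed.

Lemma gamma_fun_shift (s x t : R) : gamma_fun (s + x) t = Rpower t x * gamma_fun s t.
Proof.
  unfold gamma_fun. replace (s + x - 1) with (x + (s - 1)) by ring.
  rewrite Rpower_plus. ring.
Qed.

Lemma gamma_fun_succ (s t : R) : 0 < t -> gamma_fun (s + 1) t = t * gamma_fun s t.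
Proof. intros Ht. rewrite gamma_fun_shift, Rpower_1 by exact Ht. reflexivity. Qed.

Lemma Rpower_div_mult (t a x : R) : 0 < t -> 0 < a ->
  Rpower a x * Rpower (t / a) x = Rpower t x.
Proof.
  intros Ht Ha. rewrite Rpower_mult_distr; [f_equal; field; lra | exact Ha |].
  apply Rdiv_lt_0_compat; assumption.
Qed.

(** Apply [Rpower_ge_tangent] to [t / a] and integrate against
    [t ^ a * exp (- t)].  The base point [a] is the one for which the linear
    correction [x - x * a / t] integrates to 0, by [Gamma_succ]. *)
Lemma Gamma_ge (a x : R) : 1 <= a -> 0 <= x ->
  Rpower a x * Gamma (a + 1) <= Gamma (a + 1 + x).
Proof.
  intros Ha Hx.
  assert (H := is_RInt_half_line_minus _ _ _ _ (is_Gamma (a + 1 + x) ltac:(lra))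
     (is_RInt_half_line_scal _ (Rpower a x) _
       (is_RInt_half_line_minus _ _ _ _
         (is_RInt_half_line_scal _ (1 + x) _ (is_Gamma (a + 1) ltac:(lra)))
         (is_RInt_half_line_scal _ (x * a) _ (is_Gamma a Ha))))).
  apply is_RInt_half_line_ge_0 in H.
  - change (0 <= Gamma (a + 1 + x) -
      Rpower a x * ((1 + x) * Gamma (a + 1) - x * a * Gamma a)) in H.
    replace (x * a * Gamma a) with (x * Gamma (a + 1)) in H
      by (rewrite Gamma_succ by exact Ha; ring).
    lra.
  - clear H. intros t Ht.
    change (0 <= gamma_fun (a + 1 + x) t -
      Rpower a x * ((1 + x) * gamma_fun (a + 1) t - x * a * gamma_fun a t)).
    rewrite gamma_fun_shift, gamma_fun_succ, <- (Rpower_div_mult t a x) by lra.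
    assert (Hta : 0 < t / a) by (apply Rdiv_lt_0_compat; lra).
    assert (H := Rpower_ge_tangent (t / a) x Hta Hx).
    replace (Rpower a x * Rpower (t / a) x * (t * gamma_fun a t) -
       Rpower a x * ((1 + x) * (t * gamma_fun a t) - x * a * gamma_fun a t))
      with (Rpower a x * (t * gamma_fun a t) * (Rpower (t / a) x - (1 + x - x / (t / a))))
      by (field; lra).
    assert (0 < Rpower a x) by apply exp_pos. assert (Hg := gamma_fun_pos a t).
    apply Rmult_le_pos; [|lra]. apply Rmult_le_pos; [lra|]. apply Rmult_le_pos; lra.
Qed.

(** The counterpart of [Gamma_ge]: integrate [Rpower_ge_tangent] at
    [(s + x) / t] against [t ^ (s + x - 1) * exp (- t)].  The base point [s + x]
    makes the linear correction integrate to 0. *)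
Lemma Gamma_le (s x : R) : 1 <= s -> 0 <= x ->
  Gamma (s + x) <= Rpower (s + x) x * Gamma s.
Proof.
  intros Hs Hx. set (m := s + x).
  assert (H := is_RInt_half_line_minus _ _ _ _
     (is_RInt_half_line_scal _ (Rpower m x) _ (is_Gamma s Hs))
     (is_RInt_half_line_minus _ _ _ _
         (is_RInt_half_line_scal _ (1 + x) _ (is_Gamma m ltac:(unfold m; lra)))
         (is_RInt_half_line_scal _ (x / m) _ (is_Gamma (m + 1) ltac:(unfold m; lra))))).
  apply is_RInt_half_line_ge_0 in H.
  - change (0 <= Rpower m x * Gamma s - ((1 + x) * Gamma m - x / m * Gamma (m + 1))) in H.
    replace (x / m * Gamma (m + 1)) with (x * Gamma m) in H
      by (rewrite Gamma_succ by (unfold m; lra); field; unfold m; lra).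
    lra.
  - clear H. intros t Ht.
    change (0 <= Rpower m x * gamma_fun s t -
      ((1 + x) * gamma_fun m t - x / m * gamma_fun (m + 1) t)).
    assert (Hm : 0 < m) by (unfold m; lra).
    rewrite gamma_fun_succ by exact Ht.
    replace (gamma_fun m t) with (Rpower t x * gamma_fun s t) by (symmetry; apply gamma_fun_shift).
    assert (Hta : 0 < m / t) by (apply Rdiv_lt_0_compat; lra).
    assert (H := Rpower_ge_tangent (m / t) x Hta Hx).
    rewrite <- (Rpower_div_mult m t x) by lra.
    replace (Rpower t x * Rpower (m / t) x * gamma_fun s t -
       ((1 + x) * (Rpower t x * gamma_fun s t) - x / m * (t * (Rpower t x * gamma_fun s t))))
      with (Rpower t x * gamma_fun s t * (Rpower (m / t) x - (1 + x - x / (m / t))))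
      by (field; lra).
    assert (0 < Rpower t x) by apply exp_pos. assert (Hg := gamma_fun_pos s t).
    apply Rmult_le_pos; [|lra]. apply Rmult_le_pos; lra.
Qed.

Lemma Gamma_2 : Gamma 2 = 1.
Proof. replace 2 with (1 + 1) by ring. rewrite Gamma_succ, Gamma_1; lra. Qed.

(** The lower bound of [Gamma_ge] gives positivity from 2 on, and the functional
    equation brings it back by one. *)
Lemma Gamma_pos (x : R) : 0 <= x -> 0 < Gamma (x + 1).
Proof.
  intros Hx.
  assert (H : 0 < Gamma (x + 1 + 1)).
  { apply Rlt_le_trans with (Rpower 1 x * Gamma (1 + 1)).
    - apply Rmult_lt_0_compat; [apply exp_pos|]. replace (1 + 1) with 2 by ring. rewrite Gamma_2; lra.
    - replace (x + 1 + 1) with (1 + 1 + x) by ring. apply Gamma_ge; lra. }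
  rewrite Gamma_succ in H by lra.
  apply (Rmult_lt_reg_l (x + 1)); lra.
Qed.

Lemma ln_Gamma_bounds (a x : R) : 1 <= a -> 0 <= x ->
  x * ln a <= ln (Gamma (a + x + 1)) - ln (Gamma (a + 1)) <= x * ln (a + x + 1).
Proof.
  intros Ha Hx. assert (H := Gamma_pos a ltac:(lra)).
  assert (H1 := Gamma_ge a x Ha Hx).
  assert (H2 := Gamma_le (a + 1) x ltac:(lra) Hx).
  replace (a + 1 + x) with (a + x + 1) in H1, H2 by ring.
  assert (Hp := Gamma_pos (a + x) ltac:(lra)).
  assert (Hr : forall b, 0 < Rpower b x) by (intros; apply exp_pos).
  split.
  - apply ln_le in H1; [|apply Rmult_lt_0_compat; auto].
    rewrite ln_mult in H1 by auto. unfold Rpower in H1. rewrite ln_exp in H1. lra.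
  - apply ln_le in H2; [|exact Hp].
    rewrite ln_mult in H2 by auto. unfold Rpower in H2. rewrite ln_exp in H2. lra.
Qed.

(** * Wallis' integrals and Stirling's formula *)

Definition wallis (n : nat) : R := RInt (fun t => sin t ^ n) 0 (PI / 2).

Lemma ex_RInt_sin_pow (n : nat) (a b : R) : ex_RInt (fun t => sin t ^ n) a b.
Proof.
  apply (ex_RInt_continuous (V := R_CompleteNormedModule)). intros z _.
  apply (ex_derive_continuous (V := R_NormedModule)). auto_derive; trivial.
Qed.

Lemma wallis_0 : wallis 0 = PI / 2.
Proof.
  unfold wallis; simpl. rewrite RInt_const. unfold scal; simpl; unfold mult; simpl. ring.
Qed.

Lemma wallis_1 : wallis 1 = 1.
Proof.
  unfold wallis. replace 1 with (- cos (PI / 2) - - cos 0) by (rewrite cos_PI2, cos_0; ring).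
  apply is_RInt_unique. apply (is_RInt_derive (fun t => - cos t)).
  - intros t _. auto_derive; trivial; ring.
  - intros t _. apply (ex_derive_continuous (V := R_NormedModule)). auto_derive; trivial.
Qed.

(** Integrates the derivative of [- cos t * sin t ^ (n + 1)], which vanishes at
    both ends. *)
Lemma wallis_succ_succ (n : nat) :
  (INR n + 2) * wallis (S (S n)) = (INR n + 1) * wallis n.
Proof.
  assert (H : is_RInt (fun t => (INR n + 2) * sin t ^ S (S n) - (INR n + 1) * sin t ^ n)
                0 (PI / 2) 0).
  { replace 0 with (- cos (PI / 2) * sin (PI / 2) ^ S n - - cos 0 * sin 0 ^ S n) at 2
      by (rewrite cos_PI2, sin_0; simpl; ring).
    apply (is_RInt_derive (fun t => - cos t * sin t ^ S n)).
    - intros t _. auto_derive; trivial.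
      replace (match n with 0%nat => 1 | S _ => INR n + 1 end) with (INR n + 1)
        by (destruct n; simpl; ring).
      assert (E : cos t * cos t = 1 - sin t * sin t)
        by (generalize (sin2_cos2 t); unfold Rsqr; lra).
      simpl. transitivity (sin t * (sin t * sin t ^ n) - (INR n + 1) * (cos t * cos t) * sin t ^ n).
      + ring.
      + rewrite E. ring.
    - intros t _. apply (ex_derive_continuous (V := R_NormedModule)). auto_derive; trivial. }
  assert (H' := is_RInt_minus _ _ _ _ _ _
    (is_RInt_scal _ _ _ (INR n + 2) _ (RInt_correct _ _ _ (ex_RInt_sin_pow (S (S n)) 0 (PI / 2))))
    (is_RInt_scal _ _ _ (INR n + 1) _ (RInt_correct _ _ _ (ex_RInt_sin_pow n 0 (PI / 2))))).
  apply (is_RInt_unique (V := R_CompleteNormedModule)) in H.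
  apply (is_RInt_unique (V := R_CompleteNormedModule)) in H'.
  change (RInt (fun t => (INR n + 2) * sin t ^ S (S n) - (INR n + 1) * sin t ^ n) 0 (PI / 2)
    = (INR n + 2) * wallis (S (S n)) - (INR n + 1) * wallis n) in H'.
  lra.
Qed.

Lemma wallis_nonneg (n : nat) : 0 <= wallis n.
Proof.
  apply RInt_ge_0; [generalize PI_RGT_0; lra | apply ex_RInt_sin_pow |].
  intros t Ht. apply pow_le, sin_ge_0; generalize PI_RGT_0; lra.
Qed.

Lemma wallis_decr (n : nat) : wallis (S n) <= wallis n.
Proof.
  apply RInt_le; try apply ex_RInt_sin_pow. { generalize PI_RGT_0; lra. }
  intros t Ht. assert (H0 : 0 <= sin t) by (apply sin_ge_0; generalize PI_RGT_0; lra).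
  assert (H := pow_le _ n H0). generalize (SIN_bound t). simpl; nra.
Qed.

Lemma wallis_mult_succ (n : nat) : (INR n + 1) * (wallis n * wallis (S n)) = PI / 2.
Proof.
  induction n as [|n IH].
  - rewrite wallis_0, wallis_1. simpl; ring.
  - rewrite <- IH, S_INR. generalize (wallis_succ_succ n). intros H.
    transitivity (wallis (S n) * ((INR n + 2) * wallis (S (S n)))); [ring | rewrite H; ring].
Qed.

(** With [wallis_sqr_le], this encloses [wallis n ^ 2] between [(PI / 2) / (n + 1)]
    and [(PI / 2) / n]: the exact product [wallis_mult_succ] of consecutive
    integrals, and their monotonicity. *)
Lemma wallis_sqr_ge (n : nat) : PI / 2 <= (INR n + 1) * wallis n ^ 2.
Proof.
  rewrite <- (wallis_mult_succ n). apply Rmult_le_compat_l; [generalize (pos_INR n); lra|].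
  generalize (wallis_decr n) (wallis_nonneg n). nra.
Qed.

Lemma wallis_sqr_le (n : nat) : INR n * wallis n ^ 2 <= PI / 2.
Proof.
  destruct n as [|n]. { simpl. generalize PI_RGT_0; lra. }
  rewrite <- (wallis_mult_succ n), S_INR.
  apply Rmult_le_compat_l; [generalize (pos_INR n); lra|].
  generalize (wallis_decr n) (wallis_nonneg (S n)). nra.
Qed.

Lemma wallis_pos (n : nat) : 0 < wallis n.
Proof.
  destruct (wallis_nonneg n) as [H|H]; [exact H|].
  generalize (wallis_mult_succ n) PI_RGT_0. rewrite <- H. lra.
Qed.

(** Both sides satisfy the same recurrence.  Writing the factorials as values of
    Gamma avoids a detour through [fact]. *)
Lemma wallis_even_Gamma (n : nat) :
  wallis (2 * n) * 4 ^ n * Gamma (INR n + 1) ^ 2 = PI / 2 * Gamma (2 * INR n + 1).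
Proof.
  induction n as [|n IH].
  - simpl. rewrite wallis_0, Rmult_0_r, Rplus_0_l, Gamma_1. ring.
  - replace (2 * S n)%nat with (S (S (2 * n))) by lia.
    assert (Hn := pos_INR n). rewrite S_INR.
    rewrite (Gamma_succ (INR n + 1)) by lra.
    replace (2 * (INR n + 1) + 1) with (2 * INR n + 1 + 1 + 1) by ring.
    rewrite (Gamma_succ (2 * INR n + 1 + 1)), (Gamma_succ (2 * INR n + 1)) by lra.
    transitivity ((2 * INR n + 1 + 1) * (2 * INR n + 1)
                  * (wallis (2 * n) * 4 ^ n * Gamma (INR n + 1) ^ 2)); [|rewrite IH; ring].
    assert (H := wallis_succ_succ (2 * n)). rewrite mult_INR in H. simpl INR in H.
    replace (wallis (S (S (2 * n)))) with
      ((2 * INR n + 1) * wallis (2 * n) / (2 * INR n + 2)).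
    + simpl pow. field. lra.
    + apply (Rmult_eq_reg_l (2 * INR n + 2)); [|lra].
      replace ((1 + 1) * INR n) with (2 * INR n) in H by ring. rewrite H. field. lra.
Qed.

(** Binet's function, the remainder in Stirling's formula. *)
Definition binet (x : R) : R :=
  ln (Gamma (x + 1)) - ln (sqrt (2 * PI)) - (x + 1 / 2) * ln x + x.

Lemma binet_step (x : R) : 1 <= x ->
  binet x - binet (x + 1) = (x + 1 / 2) * (ln (x + 1) - ln x) - 1.
Proof.
  intros Hx. unfold binet. rewrite (Gamma_succ (x + 1)) by lra.
  rewrite ln_mult by (try apply Gamma_pos; lra). field.
Qed.

Lemma ln_diff_bounds (a b : R) : 0 < a -> a <= b ->
  (b - a) / b <= ln b - ln a <= (b - a) / a.
Proof.
  intros Ha Hab.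
  assert (H : forall u v, 0 < u -> 0 < v -> ln u - ln v <= (u - v) / v).
  { intros u v Hu Hv. assert (Huv : 0 < u / v) by (apply Rdiv_lt_0_compat; assumption).
    generalize (exp_ineq1_le (ln (u / v))). rewrite exp_ln by exact Huv.
    rewrite ln_div by assumption.
    replace ((u - v) / v) with (u / v - 1) by (field; lra). lra. }
  split; [|apply H; lra].
  generalize (H a b Ha ltac:(lra)).
  replace ((a - b) / b) with (- ((b - a) / b)) by (field; lra). lra.
Qed.

(** The midpoint and the trapezoidal rule enclose the integral of the convex
    function [1 / t] over [x, x + 1].  The telescoping form of the upper bound
    makes [binet] bounded along the integers. *)
Lemma binet_step_bounds (x : R) : 0 < x ->
  0 <= (x + 1 / 2) * (ln (x + 1) - ln x) - 1 <= 1 / (4 * x) - 1 / (4 * (x + 1)).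
Proof.
  intros Hx. set (u := / x).
  assert (Hu : 0 < u) by (apply Rinv_0_lt_compat, Hx).
  assert (E : ln (x + 1) - ln x = ln (1 + u)).
  { rewrite <- ln_div by lra. f_equal. unfold u. field. lra. }
  rewrite E.
  assert (H1 : ln (1 + 0) - 2 * 0 / (2 + 0) <= ln (1 + u) - 2 * u / (2 + u)).
  { apply (le_of_derive_nonneg (fun u => ln (1 + u) - 2 * u / (2 + u))
             (fun u => u ^ 2 / ((1 + u) * (2 + u) ^ 2))); [lra | |].
    - intros t Ht. auto_derive; [lra | field; lra].
    - intros t Ht. apply Rmult_le_pos; [nra|]. left. apply Rinv_0_lt_compat.
      apply Rmult_lt_0_compat; [lra | apply pow_lt; lra]. }
  assert (H2 : 0 / 2 + 0 / (2 * (1 + 0)) - ln (1 + 0) <= u / 2 + u / (2 * (1 + u)) - ln (1 + u)).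
  { apply (le_of_derive_nonneg (fun u => u / 2 + u / (2 * (1 + u)) - ln (1 + u))
             (fun u => u ^ 2 / (2 * (1 + u) ^ 2))); [lra | |].
    - intros t Ht. auto_derive; [lra | field; lra].
    - intros t Ht. apply Rmult_le_pos; [nra|]. left. apply Rinv_0_lt_compat.
      apply Rmult_lt_0_compat; [lra | apply pow_lt; lra]. }
  rewrite Rplus_0_r, ln_1 in H1, H2.
  replace (2 * 0 / (2 + 0)) with 0 in H1 by field.
  replace (0 / 2 + 0 / (2 * 1)) with 0 in H2 by field.
  split.
  - apply Rle_trans with ((x + 1 / 2) * (2 * u / (2 + u)) - 1).
    + right. unfold u. field. lra.
    + assert (0 <= (x + 1 / 2) * (ln (1 + u) - 2 * u / (2 + u)))
        by (apply Rmult_le_pos; lra). lra.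
  - apply Rle_trans with ((x + 1 / 2) * (u / 2 + u / (2 * (1 + u))) - 1).
    + assert (0 <= (x + 1 / 2) * (u / 2 + u / (2 * (1 + u)) - ln (1 + u)))
        by (apply Rmult_le_pos; lra). lra.
    + right. unfold u. field. lra.
Qed.

(** In [2 * binet n - binet (2 * n)] the Gamma values form a central binomial
    coefficient, which is a Wallis integral. *)
Lemma binet_duplication (n : nat) : (0 < n)%nat ->
  2 * binet (INR n) - binet (2 * INR n)
  = / 2 * (ln (PI / 2) - ln (2 * INR n * wallis (2 * n) ^ 2)).
Proof.
  intros Hn. assert (Hn' : 1 <= INR n) by (apply (le_INR 1); lia).
  assert (HG := Gamma_pos (INR n) ltac:(lra)). assert (HG2 := Gamma_pos (2 * INR n) ltac:(lra)).
  assert (HW := wallis_pos (2 * n)). assert (HP := PI_RGT_0).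
  assert (E := f_equal ln (wallis_even_Gamma n)).
  rewrite !ln_mult, !ln_pow in E by (try apply Rmult_lt_0_compat; try apply pow_lt; lra).
  replace (ln 4) with (2 * ln 2) in E by (replace 4 with (2 * 2) by ring; rewrite ln_mult by lra; ring).
  unfold binet. rewrite <- Rpower_sqrt by lra. unfold Rpower. rewrite ln_exp.
  assert (0 < wallis (2 * n) ^ 2) by apply pow_lt, HW.
  rewrite (ln_mult (2 * INR n)), (ln_mult 2 (INR n)), (ln_mult 2 PI), ln_pow by lra.
  rewrite ln_div in E |- * by lra. change (INR 2) with 2 in *.
  assert (E' : ln (Gamma (2 * INR n + 1)) = ln (wallis (2 * n)) + INR n * (2 * ln 2) +
    2 * ln (Gamma (INR n + 1)) - (ln PI - ln 2)) by lra.
  rewrite E'. field.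
Qed.

(** Along the integers [binet] decreases and is bounded below, so it has a limit
    [l].  Then [2 * binet n - binet (2 * n)] tends to [l], while Wallis' bounds
    force this expression to 0. *)
Lemma binet_lim_nat : is_lim_seq (fun n => binet (INR (S n))) 0.
Proof.
  assert (Hdec : forall n, 0 <= binet (INR (S n)) - binet (INR (S (S n)))
            <= 1 / (4 * INR (S n)) - 1 / (4 * INR (S (S n)))).
  { intros n. rewrite (S_INR (S n)).
    assert (Hn : 1 <= INR (S n)) by (apply (le_INR 1); lia).
    rewrite binet_step by exact Hn. apply binet_step_bounds; lra. }
  destruct (ex_finite_lim_seq_decr (fun n => binet (INR (S n))) (binet 1 - 1 / 4)) as [l Hl].
  - intros n. specialize (Hdec n). lra.
  - intros n. assert (H : binet 1 - 1 / 4 <= binet (INR (S n)) - 1 / (4 * INR (S n))).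
    { induction n as [|n IH]; [simpl; right; field | specialize (Hdec n); lra]. }
    assert (0 < 1 / (4 * INR (S n))).
    { apply Rdiv_lt_0_compat; [lra|]. generalize (lt_0_INR (S n) ltac:(lia)). lra. }
    lra.
  - replace 0 with l; [exact Hl|].
    assert (H1 : is_lim_seq (fun n => 2 * binet (INR (S n)) - binet (INR (S (2 * n + 1)))) (2 * l - l)).
    { apply is_lim_seq_minus'.
      - apply (is_lim_seq_scal_l _ 2 (Finite l)), Hl.
      - apply (is_lim_seq_subseq (fun n => binet (INR (S n))) l (fun n => 2 * n + 1)%nat); [|exact Hl].
        apply eventually_subseq. intros n; lia. }
    assert (H2 : is_lim_seq (fun n => 2 * binet (INR (S n)) - binet (INR (S (2 * n + 1)))) 0).
    { apply (is_lim_seq_le_le (fun _ => 0) _ (fun n => / (INR n + 1))).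
      - intros n. replace (S (2 * n + 1)) with (2 * S n)%nat by lia.
        rewrite mult_INR. change (INR 2) with 2. rewrite binet_duplication by lia.
        assert (Hle := wallis_sqr_le (2 * S n)). assert (Hge := wallis_sqr_ge (2 * S n)).
        rewrite mult_INR in Hle, Hge. change (INR 2) with 2 in Hle, Hge.
        assert (HW : 0 < wallis (2 * S n) ^ 2) by apply pow_lt, wallis_pos.
        assert (HN : 1 <= INR (S n)) by (apply (le_INR 1); lia).
        assert (HP := PI_RGT_0). rewrite <- S_INR.
        set (N := INR (S n)) in *. set (w := wallis (2 * S n) ^ 2) in *.
        apply ln_le in Hle; [|apply Rmult_lt_0_compat; lra].
        apply ln_le in Hge; [|lra].
        destruct (ln_diff_bounds (2 * N) (2 * N + 1) ltac:(lra) ltac:(lra)) as [_ Hd].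
        rewrite ln_mult in Hge by lra. rewrite (ln_mult (2 * N)) in * by lra.
        replace ((2 * N + 1 - 2 * N) / (2 * N)) with (/ 2 * / N) in Hd by (field; lra).
        assert (0 < / N) by (apply Rinv_0_lt_compat; lra).
        lra.
      - apply is_lim_seq_const.
      - apply (is_lim_seq_inv _ p_infty); [|discriminate].
        apply is_lim_seq_ext with (fun n => INR (S n)); [intros; apply S_INR|].
        apply (is_lim_seq_incr_1 INR), is_lim_seq_INR. }
    apply is_lim_seq_unique in H1. apply is_lim_seq_unique in H2.
    rewrite H1 in H2. injection H2. lra.
Qed.

Lemma inv_succ_lim (c : R) : is_lim_seq (fun n => c * / INR (S n)) 0.
Proof.
  replace (Finite 0) with (Rbar_mult c 0) by (simpl; f_equal; ring).
  apply is_lim_seq_scal_l. apply (is_lim_seq_inv _ p_infty); [|discriminate].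
  apply (is_lim_seq_incr_1 INR), is_lim_seq_INR.
Qed.

(** By [ln_Gamma_bounds], [binet (x + N)] differs from [binet N] by at most
    [(x + x ^ 2) / N]. *)
Lemma binet_lim (x : R) : 0 <= x -> is_lim_seq (fun n => binet (x + INR (S n))) 0.
Proof.
  intros Hx.
  apply is_lim_seq_ext with
    (fun n => binet (INR (S n)) + (binet (x + INR (S n)) - binet (INR (S n)))); [intros; ring|].
  replace (Finite 0) with (Finite (0 + 0)) by (f_equal; ring).
  apply is_lim_seq_plus'; [apply binet_lim_nat|].
  apply (is_lim_seq_le_le (fun n => - (x + x ^ 2) * / INR (S n)) _
           (fun n => (x + x ^ 2) * / INR (S n))); try apply inv_succ_lim.
  intros n. assert (HN : 1 <= INR (S n)) by (apply (le_INR 1); lia).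
  generalize dependent (INR (S n)); clear n; intros N HN.
  destruct (ln_Gamma_bounds N x HN Hx) as [HG1 HG2].
  replace (N + x) with (x + N) in * by ring.
  destruct (ln_diff_bounds N (x + N)) as [Hd1 Hd2]; try lra.
  destruct (ln_diff_bounds (x + N) (x + N + 1)) as [_ Hd3]; try lra.
  assert (HNi : 0 < / N) by (apply Rinv_0_lt_compat; lra).
  assert (HxNi : / (x + N) <= / N) by (apply Rinv_le_contravar; lra).
  replace ((x + N + 1 - (x + N)) / (x + N)) with (/ (x + N)) in Hd3 by (field; lra).
  replace ((x + N - N) / N) with (x * / N) in Hd2 by (field; lra).
  replace (x + N - N) with x in Hd1 by ring.
  unfold binet. set (c := ln (sqrt (2 * PI))). clearbody c.
  split.
  - assert (H1 : x * (ln (x + N) - ln N) <= x * (x * / N)) by (apply Rmult_le_compat_l; lra).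
    assert (H2 : (N + 1 / 2) * (ln (x + N) - ln N) <= (N + 1 / 2) * (x * / N))
      by (apply Rmult_le_compat_l; lra).
    replace ((N + 1 / 2) * (x * / N)) with (x + x * / N / 2) in H2 by (field; lra).
    assert (0 <= x * / N) by (apply Rmult_le_pos; lra). lra.
  - assert (H1 : x * (ln (x + N + 1) - ln (x + N)) <= x * / N)
      by (apply Rmult_le_compat_l; lra).
    assert (H2 : (N + 1 / 2) * (x / (x + N)) <= (N + 1 / 2) * (ln (x + N) - ln N))
      by (apply Rmult_le_compat_l; lra).
    assert (H3 : x - x ^ 2 * / N <= (N + 1 / 2) * (x / (x + N))).
    { apply Rle_trans with (x - x ^ 2 * / (x + N)).
      - assert (0 <= x ^ 2) by apply pow2_ge_0. nra.
      - apply Rle_trans with (N * (x / (x + N))).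
        + right. field. lra.
        + apply Rmult_le_compat_r; [|lra]. apply Rmult_le_pos; [lra|].
          left; apply Rinv_0_lt_compat; lra. }
    lra.
Qed.

(** * Convex functions tending to zero *)

Definition strictly_convex_from (a : R) (f : R -> R) : Prop :=
  forall x y t, a <= x -> x < y -> 0 < t < 1 ->
    f (t * x + (1 - t) * y) < t * f x + (1 - t) * f y.

Lemma strictly_convex_of_derive2 (f f1 f2 : R -> R) (a : R) :
  (forall x, a <= x -> is_derive f x (f1 x)) ->
  (forall x, a <= x -> is_derive f1 x (f2 x)) ->
  (forall x, a <= x -> 0 < f2 x) ->
  strictly_convex_from a f.
Proof.
  intros H1 H2 Hpos x y t Hx Hxy Ht. set (z := t * x + (1 - t) * y).
  assert (Hz : x < z < y) by (unfold z; nra).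
  destruct (MVT_cor2 f f1 x z) as [c [Ec Hc]]; [lra | |].
  { intros w Hw. apply is_derive_Reals, H1; lra. }
  destruct (MVT_cor2 f f1 z y) as [d [Ed Hd]]; [lra | |].
  { intros w Hw. apply is_derive_Reals, H1; lra. }
  destruct (MVT_cor2 f1 f2 c d) as [e [Ee He]]; [lra | |].
  { intros w Hw. apply is_derive_Reals, H2; lra. }
  assert (Hlt : 0 < f2 e * (d - c)) by (apply Rmult_lt_0_compat; [apply Hpos|]; lra).
  replace (z - x) with ((1 - t) * (y - x)) in Ec by (unfold z; ring).
  replace (y - z) with (t * (y - x)) in Ed by (unfold z; ring).
  assert (0 < t * (1 - t) * (y - x) * (f1 d - f1 c)).
  { repeat apply Rmult_lt_0_compat; lra. }
  nra.
Qed.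

Lemma strictly_convex_slope (a : R) (f : R -> R) (x y z : R) :
  strictly_convex_from a f -> a <= x -> x < y -> y < z ->
  (z - y) * (f y - f x) < (y - x) * (f z - f y).
Proof.
  intros Hf Hx Hxy Hyz.
  assert (Ht : 0 < (z - y) / (z - x) < 1).
  { split; [apply Rdiv_lt_0_compat; lra|].
    apply (Rmult_lt_reg_r (z - x)); [lra|]. field_simplify; lra. }
  assert (H := Hf x z _ Hx ltac:(lra) Ht).
  replace ((z - y) / (z - x) * x + (1 - (z - y) / (z - x)) * z) with y in H by (field; lra).
  apply (Rmult_lt_compat_r (z - x)) in H; [|lra].
  replace (((z - y) / (z - x) * f x + (1 - (z - y) / (z - x)) * f z) * (z - x))
    with ((z - y) * f x + (y - x) * f z) in H by (field; lra).
  lra.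
Qed.

(** If [f x <= f y] for some [x < y], the slopes to the right of [y] stay above a
    positive constant, and [f (y + 1 + n)] tends to infinity. *)
Lemma strictly_decreasing_of_convex (a : R) (f : R -> R) :
  strictly_convex_from a f ->
  (forall x, a <= x -> is_lim_seq (fun n => f (x + INR n)) 0) ->
  forall x y, a <= x -> x < y -> f y < f x.
Proof.
  intros Hf Hlim x y Hx Hxy. apply Rnot_le_lt; intros Hle.
  assert (H1 : f y < f (y + 1)).
  { assert (H := strictly_convex_slope a f x y (y + 1) Hf Hx Hxy ltac:(lra)). nra. }
  assert (Hn : forall n, f (y + 1) + (f (y + 1) - f y) * INR n <= f (y + 1 + INR n)).
  { intros [|n]. { simpl; rewrite Rmult_0_r, !Rplus_0_r; lra. }
    assert (Hn : 0 < INR (S n)) by (apply lt_0_INR; lia).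
    assert (H := strictly_convex_slope a f y (y + 1) (y + 1 + INR (S n)) Hf
                   ltac:(lra) ltac:(lra) ltac:(lra)). lra. }
  refine (is_lim_seq_le _ _ p_infty 0 Hn _ (Hlim (y + 1) ltac:(lra))).
  apply (is_lim_seq_plus _ _ (f (y + 1)) p_infty); [apply is_lim_seq_const | | reflexivity].
  apply (is_lim_seq_mult _ _ (f (y + 1) - f y) p_infty);
    [apply is_lim_seq_const | apply is_lim_seq_INR |].
  apply is_Rbar_mult_sym, is_Rbar_mult_p_infty_pos. simpl; lra.
Qed.

(** The convexity defect of [f] at shift [n] exceeds that at shift [n + 1] by the
    defect of [g], and it tends to 0; so it is the sum of positive terms. *)
Lemma strictly_convex_telescope (a : R) (f g : R -> R) :
  (forall x, a <= x -> f x - f (x + 1) = g x) ->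
  (forall x, a <= x -> is_lim_seq (fun n => f (x + INR n)) 0) ->
  strictly_convex_from a g -> strictly_convex_from a f.
Proof.
  intros Hfg Hlim Hg x y t Hx Hxy Ht. set (z := t * x + (1 - t) * y).
  assert (Hz : x < z < y) by (unfold z; nra).
  set (e := fun n => t * f (x + INR n) + (1 - t) * f (y + INR n) - f (z + INR n)).
  assert (He : forall n, e (S n) < e n).
  { intros n. assert (Hn := pos_INR n). unfold e. rewrite S_INR.
    assert (H := Hg (x + INR n) (y + INR n) t ltac:(lra) ltac:(lra) Ht).
    replace (t * (x + INR n) + (1 - t) * (y + INR n)) with (z + INR n) in H
      by (unfold z; ring).
    rewrite <- !Hfg in H by lra. rewrite <- !Rplus_assoc. lra. }
  assert (Hl : is_lim_seq e 0).
  { replace (Finite 0) with (Finite (t * 0 + (1 - t) * 0 - 0)) by (f_equal; ring).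
    apply is_lim_seq_minus'; [apply is_lim_seq_plus'|]; try (apply Hlim; lra).
    - apply (is_lim_seq_scal_l _ t 0), Hlim; lra.
    - apply (is_lim_seq_scal_l _ (1 - t) 0), Hlim; lra. }
  assert (H1 := is_lim_seq_decr_compare e 0 Hl (fun n => Rlt_le _ _ (He n)) 1%nat).
  assert (H0 := He 0%nat). unfold e at 2 in H0. simpl INR in H0. rewrite !Rplus_0_r in H0. lra.
Qed.

(** * Limit, monotonicity and image of f0 *)

Lemma corr_bounds (x : R) : 1 <= x -> 0 <= corr x <= 2 * / x.
Proof.
  intros Hx. set (u := / x).
  assert (Hu : 0 < u <= 1).
  { split; [apply Rinv_0_lt_compat; lra|]. rewrite <- Rinv_1. apply Rinv_le_contravar; lra. }
  assert (Exu : x * u = 1) by (unfold u; field; lra).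
  assert (H1 := hyp_ge_taylor 1 u ltac:(lra)). assert (H2 := hyp_le_taylor 3 u ltac:(lra)).
  change (u <= sinh u) in H1.
  change (sinh u <= hyp_taylor 3 u + mono 3 u) in H2. simpl in H2.
  assert (H3 : 1 <= x * sinh u) by nra.
  assert (H5 : 0 <= ln (x * sinh u) <= u * u * / 3).
  { assert (H : x * sinh u <= 1 + u * u / 3).
    { apply Rle_trans with (x * (u + u * u * u / 3)); [|right; nra].
      apply Rmult_le_compat_l; [lra|]. lra. }
    split; [rewrite <- ln_1; apply ln_le; lra|].
    apply ln_le in H; [|lra].
    generalize (ln_diff_bounds 1 (1 + u * u / 3) ltac:(lra) ltac:(nra)). rewrite ln_1. lra. }
  assert (H6 : 0 <= x / 2 * ln (x * sinh u) <= u).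
  { split; [apply Rmult_le_pos; lra|].
    apply Rle_trans with (x / 2 * (u * u * / 3)); [apply Rmult_le_compat_l; lra | nra]. }
  assert (H7 : 0 <= 7 / 324 * (1 / (x ^ 3 * (35 * x ^ 2 + 33))) <= u).
  { assert (Hx2 : 1 <= x ^ 2) by nra.
    assert (Hx3 : x <= x ^ 3) by (simpl in *; nra).
    assert (Hle : x <= x ^ 3 * (35 * x ^ 2 + 33)) by nra.
    apply Rinv_le_contravar in Hle; [|lra]. fold u in Hle.
    assert (0 < / (x ^ 3 * (35 * x ^ 2 + 33))) by (apply Rinv_0_lt_compat; nra).
    unfold Rdiv. lra. }
  unfold corr. replace (1 / x) with u by (unfold u; field; lra). lra.
Qed.

Lemma f0_eq_binet (x : R) : f0 x = binet x - corr x.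
Proof. unfold f0, binet, corr. ring. Qed.

Lemma f0_gap (x : R) : 1 <= x -> f0 x - f0 (x + 1) = gap x.
Proof.
  intros Hx. rewrite !f0_eq_binet. unfold gap. rewrite <- binet_step by exact Hx. ring.
Qed.

Lemma f0_lim (x : R) : 1 <= x -> is_lim_seq (fun n => f0 (x + INR n)) 0.
Proof.
  intros Hx. apply is_lim_seq_incr_1.
  apply is_lim_seq_ext with (fun n => binet (x + INR (S n)) - corr (x + INR (S n))).
  { intros n; symmetry; apply f0_eq_binet. }
  replace (Finite 0) with (Finite (0 - 0)) by (f_equal; ring).
  apply is_lim_seq_minus'; [apply binet_lim; lra|].
  apply (is_lim_seq_le_le (fun _ => 0) _ (fun n => 2 * / INR (S n)));
    [| apply is_lim_seq_const | apply inv_succ_lim].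
  intros n. assert (Hn : 0 < INR (S n)) by (apply lt_0_INR; lia).
  destruct (corr_bounds (x + INR (S n)) ltac:(lra)) as [H1 H2]. split; [exact H1|].
  apply Rle_trans with (1 := H2). apply Rmult_le_compat_l; [lra|].
  apply Rinv_le_contravar; lra.
Qed.

Lemma f0_strictly_convex : strictly_convex_from 1 f0.
Proof.
  apply (strictly_convex_telescope 1 f0 gap f0_gap f0_lim).
  apply (strictly_convex_of_derive2 gap gap1 gap2).
  - intros x Hx; apply is_derive_gap; lra.
  - intros x Hx; apply is_derive_gap1; lra.
  - apply gap2_pos.
Qed.

Lemma f0_decreasing (x y : R) : 1 <= x -> x < y -> f0 y < f0 x.
Proof. apply (strictly_decreasing_of_convex 1 f0 f0_strictly_convex f0_lim). Qed.

Lemma f0_pos (x : R) : 1 <= x -> 0 < f0 x.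
Proof.
  intros Hx. apply Rle_lt_trans with (f0 (x + 1)); [|apply f0_decreasing; lra].
  assert (H := is_lim_seq_decr_compare (fun n => f0 (x + INR n)) 0 (f0_lim x Hx)).
  replace (x + 1) with (x + INR 1) by (simpl; ring). apply H.
  intros n. left. rewrite S_INR. assert (Hn := pos_INR n). apply f0_decreasing; lra.
Qed.

(** The increments in [ln_Gamma_bounds] are at most [x + 2] times the
    displacement near [x]. *)
Lemma ln_Gamma_continuous (x : R) : 1 < x -> continuous (fun x => ln (Gamma (x + 1))) x.
Proof.
  intros Hx. apply (filterlim_locally (fun x => ln (Gamma (x + 1)))). intros [e He].
  assert (Hk : 0 < e / (x + 2)) by (apply Rdiv_lt_0_compat; lra).
  assert (Hd : 0 < Rmin 1 (Rmin (x - 1) (e / (x + 2)))) by (repeat apply Rmin_pos; lra).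
  exists (mkposreal _ Hd). intros y Hy. change (Rabs (y - x) < Rmin 1 (Rmin (x - 1) (e / (x + 2)))) in Hy.
  change (Rabs (ln (Gamma (y + 1)) - ln (Gamma (x + 1))) < e).
  assert (H1 := Rmin_l 1 (Rmin (x - 1) (e / (x + 2)))).
  assert (H2 := Rmin_r 1 (Rmin (x - 1) (e / (x + 2)))).
  assert (H3 := Rmin_l (x - 1) (e / (x + 2))). assert (H4 := Rmin_r (x - 1) (e / (x + 2))).
  assert (Hxy : forall a b, 1 <= a -> a <= b -> b <= x + 1 -> b - a < e / (x + 2) ->
    0 <= ln (Gamma (b + 1)) - ln (Gamma (a + 1)) < e).
  { intros a b Ha Hab Hb Hba. destruct (ln_Gamma_bounds a (b - a)) as [G1 G2]; try lra.
    replace (a + (b - a)) with b in * by ring.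
    assert (L1 : 0 <= ln a) by (rewrite <- ln_1; apply ln_le; lra).
    assert (L2 : ln (b + 1) <= x + 2).
    { generalize (exp_ineq1_le (ln (b + 1))). rewrite exp_ln; lra. }
    assert ((b - a) * ln (b + 1) <= (b - a) * (x + 2)) by (apply Rmult_le_compat_l; lra).
    apply (Rmult_lt_compat_r (x + 2)) in Hba; [|lra].
    replace (e / (x + 2) * (x + 2)) with e in Hba by (field; lra).
    assert (0 <= (b - a) * ln a) by (apply Rmult_le_pos; lra). lra. }
  assert (Hy' := Hy). apply Rabs_lt_between in Hy'.
  destruct (Rle_or_lt x y) as [Hle|Hlt].
  - destruct (Hxy x y) as [A B]; try lra. apply Rabs_def1; lra.
  - destruct (Hxy y x) as [A B]; try lra. apply Rabs_def1; lra.
Qed.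

(** Continuity of [ln (Gamma (x + 1))] is known for [x] above 1 only; one step of
    the functional equation extends it below 1, so that the point 1 is covered
    from both sides. *)
Lemma f0_continuous (x : R) : 0 < x -> continuous f0 x.
Proof.
  intros Hx.
  assert (H : continuous (fun x => (ln (Gamma (x + 1 + 1))) +
     (- ln (x + 1) - ln (sqrt (2 * PI)) - (x + 1 / 2) * ln x + x - corr x)) x).
  { refine (continuous_plus (V := R_NormedModule) _ _ x _ _).
    - refine (continuous_comp (fun x => x + 1) (fun x => ln (Gamma (x + 1))) x _ _).
      + apply (ex_derive_continuous (V := R_NormedModule)). auto_derive; trivial.
      + apply ln_Gamma_continuous; lra.
    - apply (ex_derive_continuous (V := R_NormedModule)).
      auto_derive. repeat split; try lra.
      eexists; apply is_derive_corr, Hx. }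
  refine (continuous_ext_loc _ _ _ _ H).
  exists (mkposreal x Hx). intros y Hy. change (Rabs (y - x) < x) in Hy.
  apply Rabs_lt_between in Hy. rewrite f0_eq_binet. unfold binet.
  rewrite (Gamma_succ (y + 1)), ln_mult by (try apply Gamma_pos; lra).
  match goal with |- ?l = ?r => change (@eq R l r) end. ring.
Qed.

(** Some [f0 (1 + N)] is below [y], so the intermediate value theorem applies on
    [1, 1 + N]; the solution is not 1 because [y] is below [f0 1]. *)
Lemma f0_onto (y : R) : 0 < y < f0 1 -> exists x, 1 < x /\ f0 x = y.
Proof.
  intros Hy.
  assert (Hl := f0_lim 1 (Rle_refl 1)). apply is_lim_seq_spec in Hl.
  destruct (Hl (mkposreal y (proj1 Hy))) as [N HN]. specialize (HN (S N) ltac:(lia)).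
  simpl pos in HN. rewrite Rminus_0_r in HN. apply Rabs_lt_between in HN.
  set (b := 1 + INR (S N)) in *.
  assert (Hb : 1 < b) by (assert (0 < INR (S N)) by (apply lt_0_INR; lia); unfold b; lra).
  destruct (IVT_interv (fun x => y - f0 x) 1 b) as [x [Hx E]]; [| exact Hb | lra | lra |].
  - intros x Hx. apply continuity_pt_filterlim.
    refine (continuous_minus (V := R_NormedModule) (fun _ => y) f0 x _ _).
    + apply continuous_const.
    + apply f0_continuous; lra.
  - exists x. split; [|lra]. destruct (proj1 Hx) as [H|H]; [exact H|].
    rewrite <- H in E; lra.
Qed.

(** * The value at 1 *)

Lemma f0_1 : f0 1 = 22025 / 22032 - ln (sqrt (2 * PI * sinh 1)).
Proof.
  assert (HP := PI_RGT_0). assert (Hs : 0 < sinh 1) by (rewrite <- sinh_0; apply sinh_lt; lra).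
  unfold f0. replace (1 + 1) with 2 by ring. rewrite Gamma_2, ln_1.
  replace (1 * sinh (1 / 1)) with (sinh 1) by (rewrite Rdiv_1_r; ring).
  rewrite <- (Rpower_sqrt (2 * PI)), <- (Rpower_sqrt (2 * PI * sinh 1))
    by (try apply Rmult_lt_0_compat; lra).
  unfold Rpower. rewrite !ln_exp, (ln_mult (2 * PI)) by lra.
  field.
Qed.

(** The first [n] terms of the Leibniz series of [atan]. *)
Fixpoint atan_taylor (n : nat) (t : R) : R :=
  match n with
  | O => 0
  | S k => atan_taylor k t + (-1) ^ k * t ^ (2 * k + 1) / IZR (Z.of_nat (2 * k + 1))
  end.

(** The derivative of the series is geometric; its remainder has a closed form of
    constant sign. *)
Lemma is_derive_atan_remainder (n : nat) (t : R) :
  is_derive (fun t => (-1) ^ n * (atan t - atan_taylor n t)) t (t ^ (2 * n) / (1 + t ^ 2)).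
Proof.
  assert (Ht : 0 < 1 + t ^ 2) by (generalize (pow2_ge_0 t); lra).
  assert (Hsq : (-1) ^ n * (-1) ^ n = 1) by (rewrite <- Rpow_mult_distr; replace (-1 * -1) with 1 by ring; apply pow1).
  cut (is_derive (fun t => atan t - atan_taylor n t) t ((-1) ^ n * t ^ (2 * n) / (1 + t ^ 2))).
  { intros H. replace (t ^ (2 * n) / (1 + t ^ 2)) with
      ((-1) ^ n * ((-1) ^ n * t ^ (2 * n) / (1 + t ^ 2))).
    - exact (is_derive_scal _ _ _ _ H).
    - unfold Rdiv. rewrite <- !Rmult_assoc, Hsq. ring. }
  clear Hsq. induction n as [|n IH].
  - apply is_derive_ext with atan; [intros; simpl; ring|].
    replace ((-1) ^ 0 * t ^ (2 * 0) / (1 + t ^ 2)) with (/ (1 + t²)) by (unfold Rsqr; simpl; field; simpl in Ht; lra).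
    apply is_derive_atan.
  - apply is_derive_ext with (fun t => (atan t - atan_taylor n t)
      - (-1) ^ n / IZR (Z.of_nat (2 * n + 1)) * t ^ (2 * n + 1)).
    { intros s. match goal with |- ?l = ?r => change (@eq R l r) end.
      change (atan_taylor (S n) s) with
        (atan_taylor n s + (-1) ^ n * s ^ (2 * n + 1) / IZR (Z.of_nat (2 * n + 1))).
      unfold Rdiv. ring. }
    assert (HZ : 0 < IZR (Z.of_nat (2 * n + 1))) by (apply IZR_lt; lia).
    replace ((-1) ^ S n * t ^ (2 * S n) / (1 + t ^ 2)) with
      ((-1) ^ n * t ^ (2 * n) / (1 + t ^ 2) - (-1) ^ n * t ^ (2 * n)).
    + refine (is_derive_minus _ _ _ _ _ IH _).
      replace ((-1) ^ n * t ^ (2 * n)) with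
        ((-1) ^ n / IZR (Z.of_nat (2 * n + 1)) * (IZR (Z.of_nat (2 * n + 1)) * t ^ (2 * n)))
        by (field; lra).
      refine (is_derive_scal _ _ _ _ _).
      replace (IZR (Z.of_nat (2 * n + 1))) with (INR (2 * n + 1)) by apply INR_IZR_INZ.
      rewrite Nat.add_1_r.
      generalize (is_derive_pow (fun t => t) (S (2 * n)) t 1 (is_derive_id t)).
      simpl Init.Nat.pred. rewrite Rmult_1_r. trivial.
    + replace (2 * S n)%nat with (2 + 2 * n)%nat by lia. rewrite pow_add. simpl ((-1) ^ S n).
      field. lra.
Qed.

Lemma atan_taylor_alternates (n : nat) (t : R) :
  0 <= t -> 0 <= (-1) ^ n * (atan t - atan_taylor n t).
Proof.
  intros Ht.
  assert (E0 : forall m, atan_taylor m 0 = 0).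
  { induction m as [|m IH]; [reflexivity|]. simpl atan_taylor. rewrite IH, Nat.add_1_r, pow_i by lia.
    unfold Rdiv; ring. }
  replace 0 with ((-1) ^ n * (atan 0 - atan_taylor n 0)) at 1 by (rewrite E0, atan_0; ring).
  apply (le_of_derive_nonneg (fun t => (-1) ^ n * (atan t - atan_taylor n t))
           (fun t => t ^ (2 * n) / (1 + t ^ 2)) 0 t Ht).
  - intros s _; apply is_derive_atan_remainder.
  - intros s Hs. apply Rmult_le_pos; [apply pow_le; lra|].
    left; apply Rinv_0_lt_compat. generalize (pow2_ge_0 s); lra.
Qed.

Lemma PI_bounds : 3.14159265 < PI < 3.1415926537.
Proof.
  assert (H1 := atan_taylor_alternates 6 (/ 5) ltac:(lra)).
  assert (H2 := atan_taylor_alternates 7 (/ 5) ltac:(lra)).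
  assert (H3 := atan_taylor_alternates 2 (/ 239) ltac:(lra)).
  assert (H4 := atan_taylor_alternates 3 (/ 239) ltac:(lra)).
  assert (H := Machin_4_5_239).
  simpl in H1, H2, H3, H4. lra.
Qed.

Lemma exp_neg_bounds (t : R) : 0 <= t <= 1 ->
  hyp_taylor 14 t - hyp_taylor 13 t - mono 13 t <= exp (- t)
  <= hyp_taylor 14 t + mono 14 t - hyp_taylor 13 t.
Proof.
  intros Ht. assert (E : exp (- t) = hyp 14 t - hyp 13 t).
  { change (exp (- t) = cosh t - sinh t). unfold cosh, sinh. field. }
  rewrite E.
  generalize (hyp_ge_taylor 14 t (proj1 Ht)) (hyp_le_taylor 14 t Ht)
    (hyp_ge_taylor 13 t (proj1 Ht)) (hyp_le_taylor 13 t Ht). lra.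
Qed.

(** With [i = exp (- 1)], [2 * PI * sinh 1 = PI * (i - i ^ 3) * exp 2], where the
    factor before [exp 2] is close to 1.  The claim becomes an enclosure of this
    factor between two exponentials of small numbers, of relative width
    [2 / 100000000]. *)
Lemma f0_1_approx : Rabs (f0 1 - 2407 / 100000000) <= 5 / 1000000000.
Proof.
  rewrite f0_1. assert (HP := PI_bounds).
  assert (Hs : 0 < sinh 1) by (rewrite <- sinh_0; apply sinh_lt; lra).
  set (i := exp (- (1))).
  assert (Hi : 0.3678794410 <= i <= 0.3678794412).
  { generalize (exp_neg_bounds 1 ltac:(lra)). fold i. simpl. lra. }
  assert (E : 2 * PI * sinh 1 = PI * (i - i ^ 3) * exp 2).
  { assert (Ei : exp 1 * i = 1) by (unfold i; rewrite <- exp_plus, Rplus_opp_r; apply exp_0).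
    replace (exp 2) with (exp 1 * exp 1) by (rewrite <- exp_plus; f_equal; ring).
    unfold sinh. fold i.
    transitivity (PI * (exp 1 * (exp 1 * i) - (exp 1 * i) * (exp 1 * i) * i)); [rewrite Ei; field | ring]. }
  assert (Hcube : 0.3678794410 ^ 3 <= i ^ 3 <= 0.3678794412 ^ 3).
  { split; apply pow_incr; lra. }
  assert (Hq : 0 < i - i ^ 3) by lra.
  assert (Hp : 0 < PI * (i - i ^ 3)) by (apply Rmult_lt_0_compat; lra).
  rewrite <- Rpower_sqrt by (rewrite E; apply Rmult_lt_0_compat; [exact Hp | apply exp_pos]).
  unfold Rpower. rewrite ln_exp, E, ln_mult, ln_exp by (exact Hp || apply exp_pos).
  (* [2 * f0 1 >= 4813 / 100000000], since [14 / 22032 = 2 - 2 * (22025 / 22032)].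
     The constant 4813 is twice 2406.5, that is, 2407 minus the tolerance 0.5; the
     other side uses twice 2407.5. *)
  assert (Hup : PI * (i - i ^ 3) <= exp (- (14 / 22032 + 4813 / 100000000))).
  { destruct (exp_neg_bounds (14 / 22032 + 4813 / 100000000) ltac:(lra)) as [H _].
    refine (Rle_trans _ _ _ _ H). clear H.
    apply Rle_trans with (3.1415926537 * (0.3678794412 - 0.3678794410 ^ 3)).
    - apply Rmult_le_compat; lra.
    - simpl. lra. }
  assert (Hlo : exp (- (14 / 22032 + 4815 / 100000000)) <= PI * (i - i ^ 3)).
  { destruct (exp_neg_bounds (14 / 22032 + 4815 / 100000000) ltac:(lra)) as [_ H].
    refine (Rle_trans _ _ _ H _). clear H.
    apply Rle_trans with (3.14159265 * (0.3678794410 - 0.3678794412 ^ 3)).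
    - simpl. lra.
    - apply Rmult_le_compat; lra. }
  apply ln_le in Hup; [|exact Hp].
  apply ln_le in Hlo; [|apply exp_pos].
  rewrite ln_exp in Hup, Hlo. apply Rabs_le. lra.
Qed.

Theorem theorem1 :
  strict_decreasing_on (fun x : R => 1 < x) f0 /\
  convex_on (fun x : R => 1 < x) f0 /\
  eq_Dom (image_dir f0 (fun x : R => 1 < x)) (fun y : R => 0 < y < f0 1) /\
  f0 1 = 22025 / 22032 - ln (sqrt (2 * PI * sinh 1)) /\
  Rabs (f0 1 - 2407 / 100000000) <= 5 / 1000000000.
Proof.
  split; [|split; [|split; [|split]]].
  - intros x y Hx _ Hxy. apply f0_decreasing; lra.
  - assert (Hlt : forall x y t, 1 < x -> x < y -> 0 <= t <= 1 ->
      f0 (t * x + (1 - t) * y) <= t * f0 x + (1 - t) * f0 y).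
    { intros x y t Hx Hxy Ht.
      destruct (Req_dec t 0) as [-> | H0]; [replace (0 * x + (1 - 0) * y) with y by ring; lra|].
      destruct (Req_dec t 1) as [-> | H1]; [replace (1 * x + (1 - 1) * y) with x by ring; lra|].
      left. apply f0_strictly_convex; lra. }
    intros x y t Hx Hy Ht. destruct (Rtotal_order x y) as [H|[<-|H]].
    + apply Hlt; lra.
    + replace (t * x + (1 - t) * x) with x by ring. lra.
    + generalize (Hlt y x (1 - t) Hy H ltac:(lra)).
      replace (1 - (1 - t)) with t by ring. rewrite Rplus_comm, (Rplus_comm (t * f0 x)). trivial.
  - split.
    + intros y [x [-> Hx]]. split; [apply f0_pos; lra | apply f0_decreasing; lra].
    + intros y Hy. destruct (f0_onto y Hy) as [x [Hx E]]. exists x. split; [symmetry; exact E | exact Hx].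
  - exact f0_1.
  - exact f0_1_approx.
Qed.
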